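(* Let $G$ be a snark which has a normal $5$-edge-coloring $\sigma$, let $C$ be an even subgraph of $G$, and let $\tilde{G}\in\mathcal{G}_{C}(\mathcal{A},\mathcal{B})$ be a superposition of $G$ along $C$. If for every edge $e_i\in E(C)$ the superedge $\mathcal{B}_i$ replacing $e_i$ belongs to $\{(J_{r})_{x,y} : x,y\in V(J_{r}),\ d(x,y)\geq 3\}$, where $J_r$ ($r\ge 5$ odd, possibly depending on $i$) is a Flower snark and $d$ denotes distance in $J_r$, then $\tilde{G}$ has a normal $5$-edge-coloring.
   Context: Graphs are simple, cubic and bridgeless. A snark is a bridgeless cubic graph that is not $3$-edge-colorable (no further girth or connectivity condition). Normal colorings. For a proper edge-coloring $\sigma$ of a cubic graph and a vertex $v$, $\sigma(v)$ is the set of three colors on edges at $v$. An edge $uv$ is poor (resp. rich) if $|\sigma(u)\cup\sigma(v)|=3$ (resp. $=5$). A normal $5$-edge-coloring is a proper edge-coloring with colors $1,\ldots,5$ in which every edge is poor or rich. Flower snarks. For odd $r\ge5$, $J_r$ has vertex set $\bigcup_{i=0}^{r-1}\{x_i,y_i,z_i,w_i\}$ and edge set $\bigcup_{i=0}^{r-1}\{x_ix_{i+1},\,x_iy_i,\,y_iz_i,\,y_iw_i,\,z_iw_{i+1},\,w_iz_{i+1}\}$, indices modulo $r$. Superedges. A multipole is a graph in which one also allows semiedges, i.e. edges with only one end-vertex. For a snark $H$ and distinct nonadjacent vertices $x,y$ of $H$, $H_{x,y}$ is the multipole obtained from $H$ by deleting $x$ and $y$ and turning each edge incident to $x$ or $y$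 into a semiedge at its remaining end-vertex. The three semiedges coming from $x$ form the left connector and are labelled $s_1^l,s_2^l,s_3^l$ (in any order); the three coming from $y$ form the right connector and are labelled $s_1^r,s_2^r,s_3^r$ (in any order). Superpositions. For a cycle $C=u_0u_1\cdots u_{g-1}u_0$ in $G$ (indices modulo $g$), put $e_i=u_iu_{i+1}$, let $v_i$ be the neighbor of $u_i$ other than $u_{i-1},u_{i+1}$, and $f_i=u_iv_i$. A superposition $\tilde G\in\mathcal{G}_C(\mathcal{A},\mathcal{B})$ is any cubic graph obtained from the following data, for each $i=0,\ldots,g-1$: a superedge $\mathcal{B}_i=H_{x,y}$ ($H$ a snark, $x,y$ distinct nonadjacent vertices of $H$, all possibly depending on $i$), which replaces $e_i$; a supervertex type $\mathcal{A}_i\in\{A,A'\}$; a permutation $p_i$ of $\{1,2,3\}$; and a dock index $d_i\in\{1,2,3\}$. It is constructed as follows: delete from $G$ the edges of $C$ (keeping the vertices $u_i$, the edges $f_i$ and the rest of $G$) and add disjoint copies of $\mathcal{B}_0,\ldots,\mathcal{B}_{g-1}$; for each $i$ and each $j\in\{1,2,3\}$, join the right semiedge $s^r_{p_{i-1}^{-1}(j)}$ of $\mathcal{B}_{i-1}$ with the left semiedge $s^l_j$ of $\mathcal{B}_i$ into one edge; subdivide the edge obtained for $j=d_i$ by the vertex $u_i$ (so $u_i$ has degree 3, its third edge being $f_i$). If $\mathcal{A}_i=A$ nothing more is done at $i$. If $\mathcal{A}_i=A'$, each of the two edges obtained for $j\neq d_i$ is subdivided by one new vertex, and these two new vertices are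 joined by an edge. An even subgraph $C$ of the cubic graph $G$ is a subgraph in which all degrees are even, i.e. a collection of vertex-disjoint cycles of $G$; a superposition in $\mathcal{G}_C(\mathcal{A},\mathcal{B})$ is then obtained from $G$ by doing the following for every cycle $u_0u_1\cdots u_{g-1}u_0$ of $C$ (each with its own cyclic vertex ordering and its own data $\mathcal{B}_i,\mathcal{A}_i,p_i,d_i$ for $i=0,\ldots,g-1$, indices modulo $g$): delete the edges $e_i=u_iu_{i+1}$ of the cycle and add disjoint copies of $\mathcal{B}_0,\ldots,\mathcal{B}_{g-1}$; for each $i$ and each $j\in\{1,2,3\}$ join the right semiedge $s^r_{p_{i-1}^{-1}(j)}$ of $\mathcal{B}_{i-1}$ with the left semiedge $s^l_j$ of $\mathcal{B}_i$ into one edge; subdivide the edge obtained for $j=d_i$ by the vertex $u_i$; and, if $\mathcal{A}_i=A'$, subdivide each of the two edges obtained for $j\neq d_i$ by one new vertex and join these two new vertices by an edge (if $\mathcal{A}_i=A$ nothing more is done at $i$). All other vertices and edges of $G$ are left unchanged. *)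

(* Defs.v *)
(* MathComp: finite simple graphs as symmetric irreflexive relations on a finType. *)
From HB Require Import structures.
From mathcomp Require Import all_boot all_fingroup.

Set Implicit Arguments.
Unset Strict Implicit.
Unset Printing Implicit Defensive.

Record sgraph := SGraph {
  vert :> finType;
  adj : rel vert;
  adj_sym : symmetric adj;
  adj_irr : irreflexive adj }.

Section GraphOf.
Variables (T : finType) (e : rel T).

Definition graph_of_rel : rel T := fun u v => (u != v) && (e u v || e v u).

Fact graph_of_sym : symmetric graph_of_rel.
Proof. by move=> u v; rewrite /graph_of_rel eq_sym orbC. Qed.

Fact graph_of_irr : irreflexive graph_of_rel.
Proof. by move=> u; rewrite /graph_of_rel eqxx. Qed.

(* Every edge needs to be listed by [e] in one direction only. *)
Definition graph_of : sgraph := SGraph graph_of_sym graph_of_irr.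
End GraphOf.

Definition graph_iso (G H : sgraph) (f : G -> H) : Prop :=
  bijective f /\ forall u v, adj (f u) (f v) = adj u v.

Definition isomorphic (G H : sgraph) : Prop := exists f : G -> H, graph_iso f.

Section Graphs.
Variable G : sgraph.

Definition nbrs (v : G) : {set G} := [set w | adj v w].

Definition cubic : Prop := forall v, #|nbrs v| = 3.

Definition del_edge (u v : G) : rel G :=
  fun a b => adj a b && ([set a; b] != [set u; v]).

Definition bridge (u v : G) : bool :=
  adj u v && (n_comp (@adj G) G < n_comp (del_edge u v) G).

Definition bridgeless : Prop := forall u v, ~~ bridge u v.

Definition walk (n : nat) (u v : G) : bool :=
  [exists p : n.-tuple G, path (@adj G) u p && (last u p == v)].

(* The least length of a walk from u to v; the value is #|G| when u and v lie
   in different components. *)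
Definition gdist (u v : G) : nat := find (fun n => walk n u v) (iota 0 #|G|).

(* The edge uv is the set [set u; v]; a coloring is a function on all subsets
   of G, of which only the values on edges are ever used. *)
Definition proper_coloring (k : nat) (c : {set G} -> 'I_k) : Prop :=
  forall u v w, adj u v -> adj u w -> v != w -> c [set u; v] != c [set u; w].

Definition colorable (k : nat) : Prop :=
  exists c : {set G} -> 'I_k, proper_coloring c.

Definition snark : Prop := [/\ cubic, bridgeless & ~ colorable 3].

Definition colors_at k (c : {set G} -> 'I_k) (v : G) : {set 'I_k} :=
  [set c [set v; w] | w in nbrs v].

Definition poor k (c : {set G} -> 'I_k) (u v : G) : bool :=
  #|colors_at c u :|: colors_at c v| == 3.

Definition rich k (c : {set G} -> 'I_k) (u v : G) : bool :=
  #|colors_at c u :|: colors_at c v| == 5.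

Definition normal_coloring (c : {set G} -> 'I_5) : Prop :=
  proper_coloring c /\ forall u v, adj u v -> poor c u v || rich c u v.

End Graphs.

Variant flower_label := FX | FY | FZ | FW.

Definition flower_label_code (l : flower_label) : 'I_4 :=
  match l with FX => inord 0 | FY => inord 1 | FZ => inord 2 | FW => inord 3 end.

Definition flower_label_decode (i : 'I_4) : flower_label :=
  match val i with 0 => FX | 1 => FY | 2 => FZ | _ => FW end.

Fact flower_label_codeK : cancel flower_label_code flower_label_decode.
Proof. by case; rewrite /flower_label_decode /= inordK. Qed.

HB.instance Definition _ :=
  Finite.copy flower_label (can_type flower_label_codeK).

(* [ordS i] is i + 1 modulo r. *)
Definition flower_edge (r : nat) : rel (flower_label * 'I_r) := fun a b =>
  match a.1, b.1 with
  | FX, FX | FZ, FW | FW, FZ => b.2 == ordS a.2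
  | FX, FY | FY, FZ | FY, FW => b.2 == a.2
  | _, _ => false
  end.

Definition flower (r : nat) : sgraph := graph_of (@flower_edge r).

(* The multipole H_{x,y} with labelled connectors.  As H is simple, a semiedge
   coming from x (or y) is given by its remaining end-vertex, a neighbor of x
   (or y). *)
Record superedge := Superedge {
  se_graph :> sgraph;
  se_x : se_graph;
  se_y : se_graph;
  se_left : 'I_3 -> se_graph;
  se_right : 'I_3 -> se_graph;
  se_snark : snark se_graph;
  se_neq : se_x != se_y;
  se_nonadj : ~~ adj se_x se_y;
  se_left_inj : injective se_left;
  se_left_nbr : forall j, adj se_x (se_left j);
  se_right_inj : injective se_right;
  se_right_nbr : forall j, adj se_y (se_right j) }.

Definition flower_superedge (B : superedge) : Prop :=
  exists (r : nat) (f : B -> flower r),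
    [/\ odd r, 5 <= r, graph_iso f & 3 <= gdist (f (se_x B)) (f (se_y B))].

(* A subgraph is given by its edges; isolated vertices play no role. *)
Definition even_subgraph (G : sgraph) (C : rel G) : Prop :=
  [/\ symmetric C, subrel C (@adj G) & forall u, ~~ odd #|[set v | C u v]|].

Definition on_subgraph (G : sgraph) (C : rel G) (u : G) : bool :=
  [exists v, C u v].

Variant supervertex := SvA | SvA'.

(* The cyclic orderings of all the cycles of C are given together by one
   permutation sp_next of G, which maps u_i to u_(i+1) on each cycle and fixes
   the vertices outside C.  All the data with index i on a cycle are indexed by
   the vertex u_i, so that sp_B u replaces the edge from u to sp_next u; their
   values at vertices outside C are not used. *)
Record superposition_data (G : sgraph) (C : rel G) := SuperpositionData {
  sp_next : {perm G};
  sp_nextP : forall u v,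
    C u v = (u != v) && ((v == sp_next u) || (u == sp_next v));
  sp_B : G -> superedge;
  sp_A : G -> supervertex;
  sp_p : G -> {perm 'I_3};
  sp_d : G -> 'I_3 }.

Section Superposition.
Variables (G : sgraph) (C : rel G) (D : superposition_data C).

Definition sp_prevertex : finType :=
  (G + {u : G & sp_B D u} + G * 'I_3)%type.

Definition sp_base (u : G) : sp_prevertex := inl (inl u).
Definition sp_inner (u : G) (a : sp_B D u) : sp_prevertex :=
  inl (inr (Tagged (fun u => vert (sp_B D u)) a)).
Definition sp_new (u : G) (j : 'I_3) : sp_prevertex := inr (u, j).

Definition sp_valid (t : sp_prevertex) : bool :=
  match t with
  | inl (inl u) => true
  | inl (inr q) =>
      [&& on_subgraph C (tag q), tagged q != se_x (sp_B D (tag q))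
        & tagged q != se_y (sp_B D (tag q))]
  | inr (u, j) =>
      [&& on_subgraph C u, if sp_A D u is SvA' then true else false
        & j != sp_d D u]
  end.

Definition sp_prev (u : G) : G := ((sp_next D)^-1)%g u.

(* End-vertices of the two semiedges joined at u with index j: the right
   semiedge of the previous superedge and the left semiedge of sp_B u. *)
Definition sp_right_end (u : G) (j : 'I_3) : sp_prevertex :=
  @sp_inner (sp_prev u) (se_right (sp_B D _) (((sp_p D (sp_prev u))^-1)%g j)).
Definition sp_left_end (u : G) (j : 'I_3) : sp_prevertex :=
  @sp_inner u (se_left (sp_B D u) j).

Definition sp_subdivider (u : G) (j : 'I_3) : option sp_prevertex :=
  if j == sp_d D u then Some (sp_base u)
  else if sp_A D u is SvA' then Some (sp_new u j) else None.

Definition sp_joined (u : G) (j : 'I_3) : rel sp_prevertex := fun s t =>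
  if sp_subdivider u j is Some w then
    (s == w) && ((t == sp_right_end u j) || (t == sp_left_end u j))
  else (s == sp_right_end u j) && (t == sp_left_end u j).

Definition sp_old_edge : rel sp_prevertex := fun s t =>
  match s, t with
  | inl (inl u), inl (inl v) => adj u v && ~~ C u v
  | inl (inr q), inl (inr q') =>
      (tag q == tag q') && adj (tagged q) (tagged_as q q')
  | _, _ => false
  end.

Definition sp_new_edge : rel sp_prevertex := fun s t =>
  match s, t with
  | inr (u, j), inr (v, k) => (u == v) && (j != k)
  | _, _ => false
  end.

Definition sp_edge : rel sp_prevertex := fun s t =>
  [|| sp_old_edge s t, sp_new_edge s t
    | [exists u, on_subgraph C u && [exists j, sp_joined u j s t]]].

Definition superposed : sgraph :=
  graph_of (T := {t : sp_prevertex | sp_valid t})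
    (fun s t => sp_edge (val s) (val t)).

End Superposition.

(* Main.v *)
Require Import Defs.
From HB Require Import structures.
From mathcomp Require Import all_boot all_fingroup.
From mathcomp Require Import zify.

(** The superposition carries a coloring [tau] together with a map [proj] to [G] such that every
    vertex sees under [tau] exactly the three colors which its image sees under [sigma], and such
    that adjacent vertices have equal or adjacent images.  An edge whose ends have equal images is
    then poor, and any other edge inherits poor or rich from an edge of [G]
    ([normal_of_projection]).

    Let e = uu' be an edge of [C], with color t, and let B be the superedge replacing it.  The sets
    sigma(u) and sigma(u') are equal or meet in t only.  Vertices of B are sent to u or to u', so
    B has to be properly colored in such a way that every vertex sees sigma(u) or sigma(u'); two
    adjacent vertices of different kinds are then joined by an edge colored t if e is rich.  Such a
    coloring is written with five template colors: 0 stands for t, {1, 2} for sigma(u) minus t,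
    {3, 4} for sigma(u') minus t, and each vertex sees {0, 1, 2} or {0, 3, 4}.

    The connectors are required to look as follows ([template_coloring]): the two dock semiedges are
    colored 0, the two other left semiedges are colored 1, and the two other right semiedges are
    both 0 or both 3.  This can be completed at every vertex of [C] independently of the rest of
    the cycle.  Let a, b, f be the colors in [G], at a vertex u of the cycle, of the edge entering
    u, of the edge leaving u and of the edge off the cycle.  The two free right semiedges arriving
    at u have a common color, which is a or f according to the alternative taken by the previous
    superedge.  Template color 1 of the next superedge then stands for that same color if the two
    connectors are joined directly, and for the other one of a and f if new vertices are inserted,
    the edge between the new vertices being colored b.

    So everything rests on the existence of template colorings of J_r with x and y deleted, for
    any choice of the docks, when d(x,y) >= 3 ([flower_template]).  The flower snark is a cyclic
    sequence of columns, consecutive ones being joined by three edges, and a coloring is a closed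
    walk on the triples of colors of those edges.  A walk through m >= 1 undeleted columns can
    always be replaced by a walk through m + 2 of them with the same end states
    ([two_more_columns]), so only finitely many short rings remain, and they are solved by
    computation ([base_rings_check]). *)

Set Implicit Arguments.
Unset Strict Implicit.
Unset Printing Implicit Defensive.

(** * Walks of colors through the columns of a flower snark *)

Definition triple := (nat * nat * nat)%type.

(** The colors which complete a, b to one of the triples {0, 1, 2}, {0, 3, 4}: there is at most
    one. *)
Definition third (a b : nat) : seq nat :=
  match a, b with
  | 0, 1 | 1, 0 => [:: 2]
  | 0, 2 | 2, 0 => [:: 1]
  | 1, 2 | 2, 1 => [:: 0]
  | 0, 3 | 3, 0 => [:: 4]
  | 0, 4 | 4, 0 => [:: 3]
  | 3, 4 | 4, 3 => [:: 0]
  | _, _ => [::]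
  end.

Definition seq3 (t : triple) : seq nat := [:: t.1.1; t.1.2; t.2].

Definition star (s : seq nat) : Prop := s =i [:: 0; 1; 2] \/ s =i [:: 0; 3; 4].

Lemma third_star a b c : b \in third a c -> star [:: a; b; c].
Proof.
case: a => [|[|[|[|[|a]]]]]; case: c => [|[|[|[|[|c]]]]] //=;
 rewrite mem_seq1 => /eqP ->; (try by [left=> x; rewrite !inE; lia]);
 right=> x; rewrite !inE; lia.
Qed.

Definition same_label (l l' : flower_label) : bool :=
  match l, l' with
  | FX, FX | FY, FY | FZ, FZ | FW, FW => true
  | _, _ => false
  end.

Lemma same_labelP l l' : reflect (l = l') (same_label l l').
Proof. by case: l; case: l'; constructor. Qed.

(** A column has no constraint, or has one deleted vertex whose three edges, now semiedges,
    have prescribed colors. *)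
Definition column := option (flower_label * triple).

(** The state s lists the colors of the three edges entering a column from the previous one, in
    the order x-x, z-w, w-z, and o those of the edges leaving it; m lists the colors of yx, yz,
    yw. Since z_i is joined to w_(i+1) and w_i to z_(i+1), the edge entering at z is the one
    counted by w-z. The edges at x, z, w are listed in the order entering, leaving, inside the
    column. *)
Definition cols_at (l : flower_label) (s m o : triple) : triple :=
  let: (sx, szw, swz) := s in let: (mx, mz, mw) := m in let: (ox, ozw, owz) := o in
  match l with
  | FX => (sx, ox, mx)
  | FY => (mx, mz, mw)
  | FZ => (swz, ozw, mz)
  | FW => (szw, owz, mw)
  end.

Definition vertex_ok (c : column) (l : flower_label) (t : triple) : Prop :=
  if c is Some (l0, pat) then
    if same_label l l0 then t = pat else star (seq3 t)
  else star (seq3 t).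

Definition column_ok (c : column) (s m o : triple) : Prop :=
  forall l, vertex_ok c l (cols_at l s m o).

Definition outs (c : column) (l : flower_label) (a b : nat) : seq nat :=
  if c is Some (l0, (p1, p2, p3)) then
    if same_label l l0 then if (a == p1) && (b == p3) then [:: p2] else [::]
    else third a b
  else third a b.

Lemma outsP c l a b o : o \in outs c l a b -> vertex_ok c l (a, o, b).
Proof.
case: c => [[l0 [[p1 p2] p3]]|] /=; last exact: third_star.
case: ifP => _; last exact: third_star.
by case: ifP => // /andP[/eqP -> /eqP ->]; rewrite mem_seq1 => /eqP ->.
Qed.

Definition star_pairs : seq (nat * nat) :=
  [:: (0, 1); (0, 2); (1, 2); (1, 0); (2, 0); (2, 1);
      (0, 3); (0, 4); (3, 4); (3, 0); (4, 0); (4, 3)].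

Definition mids (c : column) : seq triple :=
  if c is Some (FY, pat) then [:: pat]
  else flatten [seq [seq (p.1, z, p.2) | z <- third p.1 p.2] | p <- star_pairs].

Lemma midsP c m : m \in mids c -> vertex_ok c FY m.
Proof.
have gen : m \in flatten [seq [seq (p.1, z, p.2) | z <- third p.1 p.2] | p <- star_pairs] ->
  star (seq3 m).
  by case/flatten_mapP => p _ /mapP[z /third_star zP ->].
case: c => [[[] pat]|] //=.
by rewrite mem_seq1 => /eqP.
Qed.

Definition nexts (c : column) (s : triple) : seq triple :=
  let: (sx, szw, swz) := s in
  flatten [seq let: (mx, mz, mw) := m in
     [seq (ox, o.1, o.2) | ox <- outs c FX sx mx,
        o <- [seq (ozw, owz) | ozw <- outs c FZ swz mz, owz <- outs c FW szw mw]]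
    | m <- mids c].

Lemma nextsP c s o : o \in nexts c s -> exists m, column_ok c s m o.
Proof.
case: s => [[sx szw] swz] /flatten_mapP[[[mx mz] mw] /midsP mP].
case/allpairsP => -[ox [ozw owz]] /= [xP /allpairsP[[a b] /= [zP wP [-> ->]] ->]].
exists (mx, mz, mw) => -[] //=; exact: outsP.
Qed.

(** A search for a walk through the columns cs from state s to state t. The test by [find]
    stops at the first success even under call-by-value evaluation, which [has] would not do. *)
Fixpoint reaches (cs : seq column) (s t : triple) : bool :=
  if cs is c :: cs' then
    let ss := nexts c s in find (fun s' => reaches cs' s' t) ss < size ss
  else s == t.

Lemma reaches_cons c cs s t :
  reaches (c :: cs) s t = has (fun s' => reaches cs s' t) (nexts c s).
Proof. by rewrite has_find. Qed.

Lemma reaches_cat cs cs' s t :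
  reaches (cs ++ cs') s t <-> exists2 u, reaches cs s u & reaches cs' u t.
Proof.
elim: cs s => [|c cs IH] s.
  by split=> [st|[u /eqP -> //]]; exists s => /=.
rewrite cat_cons reaches_cons; split.
  case/hasP => s' ss' /IH[u s'u ut]; exists u => //.
  by rewrite reaches_cons; apply/hasP; exists s'.
case=> u; rewrite reaches_cons => /hasP[s' ss' s'u] ut.
by apply/hasP; exists s' => //; apply/IH; exists u.
Qed.

Lemma reaches_path cs s t : reaches cs s t ->
  exists (st md : nat -> triple), [/\ st 0 = s, st (size cs) = t
    & forall o, o < size cs -> column_ok (nth None cs o) (st o) (md o) (st o.+1)].
Proof.
elim: cs s => [|c cs IH] s.
  by move=> /eqP ->; exists (fun=> t), (fun=> t).
rewrite reaches_cons => /hasP[s' /nextsP[m mP] /IH[st [md [st0 stn stP]]]].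
(* [st o] is the state before column o, so the new column shifts all indices by one. *)
exists (fun o => if o is o'.+1 then st o' else s), (fun o => if o is o'.+1 then md o' else m).
split=> // -[_|o] /=; first by rewrite st0.
by rewrite ltnS; exact: stP.
Qed.

Definition cube : seq triple :=
  [seq (a, p.1, p.2) | a <- iota 0 5, p <- [seq (b, c) | b <- iota 0 5, c <- iota 0 5]].

Definition full_column : column := None.

Lemma two_more_columns_check :
  all (fun s => all (reaches (nseq 3 full_column) s) (nexts full_column s)) cube.
Proof. by vm_compute. Qed.

(** The colors of the three semiedges of a connector whose dock has index n. *)
Definition pattern (a b : nat) (n : nat) : triple :=
  match n with 0 => (a, b, b) | 1 => (b, a, b) | _ => (b, b, a) end.

Definition labels : seq flower_label := [:: FX; FY; FZ; FW].

(** The pairs of labels at distance at most 2 in consecutive columns. *)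
Definition near1 (l l' : flower_label) : bool :=
  match l, l' with
  | FX, FX | FX, FY | FY, FX | FY, FZ | FY, FW | FZ, FY | FW, FY
  | FZ, FW | FW, FZ => true
  | _, _ => false
  end.

(** The pairs of labels at distance at most 2 in columns i and i + 2. *)
Definition near2 (l l' : flower_label) : bool :=
  match l, l' with FX, FX | FZ, FZ | FW, FW => true | _, _ => false end.

Definition starts (lx : flower_label) (i : nat) : seq (triple * triple) :=
  flatten [seq [seq (s, t) | t <- nexts (Some (lx, pattern 0 1 i)) s] | s <- cube].

Definition ring_solvable (T : seq (triple * triple)) (ly : flower_label) (k m1 m2 : nat) : bool :=
  let try b :=
    let cs := nseq m1 full_column ++ Some (ly, pattern 0 b k) :: nseq m2 full_column in
    find (fun p => reaches cs p.2 p.1) T < size T in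
  if try 0 then true else try 3.

(** The numbers of undeleted columns on the two sides of a short ring, from which every ring
    with an odd number of columns and with distant x and y arises by inserting pairs of
    columns. A side without undeleted columns cannot be lengthened, hence the cases (0, 3) and
    (3, 0); labels that are too close at column distance 2 cannot be separated by a single
    column. *)
Definition base_lengths (lx ly : flower_label) : seq (nat * nat) :=
  (if near1 lx ly then [::] else [:: (0, 3); (3, 0)]) ++
  (if near2 lx ly then [:: (3, 2); (2, 3)] else [:: (1, 2); (2, 1)]).

(** The right alternatives 0 and 3 are both used: there are positions and docks for which only
    one of them works. *)
Lemma base_rings_check :
  all (fun lx => all (fun i => let T := starts lx i in
    all (fun ly => all (fun k =>
      all (fun m => ring_solvable T ly k m.1 m.2) (base_lengths lx ly)) (iota 0 3)) labels)
    (iota 0 3)) labels.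
Proof. by vm_compute. Qed.

Lemma star_bound s c : star s -> c \in s -> c < 5.
Proof. by case=> -> ; rewrite !inE => /or3P[] /eqP ->. Qed.

Lemma mem_cube a b c : a < 5 -> b < 5 -> c < 5 -> (a, b, c) \in cube.
Proof.
move=> a5 b5 c5; apply/allpairsP; exists (a, (b, c)); split; rewrite ?mem_iota //.
by apply/allpairsP; exists (b, c); rewrite !mem_iota.
Qed.

Lemma nexts_cube s t : t \in nexts full_column s -> s \in cube.
Proof.
case: s t => [[a b] c] [[ox oz] ow] /nextsP[[[mx mz] mw] st].
apply: mem_cube.
- by apply: (star_bound (st FX)); exact: mem_head.
- by apply: (star_bound (st FW)); exact: mem_head.
- by apply: (star_bound (st FZ)); exact: mem_head.
Qed.

(** Only the last column is replaced, by three columns; that this is possible for all pairs of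
    states is a finite check. *)
Lemma two_more_columns m s t :
  reaches (nseq m.+1 full_column) s t -> reaches (nseq m.+3 full_column) s t.
Proof.
rewrite -(addn3 m) -(addn1 m) !nseqD => /reaches_cat[u su ut].
apply/reaches_cat; exists u => //.
move: ut; rewrite reaches_cons => /hasP[t' ut' /eqP t't]; rewrite -{}t't {t}.
exact: (allP (allP two_more_columns_check _ (nexts_cube ut')) _ ut').
Qed.

Lemma more_columns m n s t : 0 < m -> m <= n -> odd m = odd n ->
  reaches (nseq m full_column) s t -> reaches (nseq n full_column) s t.
Proof.
case: m => // m _ mn odd_mn mst.
have [q ->] : exists q, n = m.+1 + q.*2 by exists (n - m.+1)./2; lia.
elim: q => [|q IH]; first by rewrite addn0.
by rewrite addSn doubleS !addnS; apply: two_more_columns; rewrite -addSn.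
Qed.

Lemma more_columns_eq m n s t : m = n \/ [/\ 0 < m, m <= n & odd m = odd n] ->
  reaches (nseq m full_column) s t -> reaches (nseq n full_column) s t.
Proof. by case=> [->|[m0 mn omn]] //; apply: more_columns. Qed.

Lemma base_lengthsP lx ly m1 m2 : odd (m1 + m2) -> 2 < m1 + m2 ->
  (near1 lx ly -> 0 < m1 /\ 0 < m2) -> (near2 lx ly -> m1 <> 1 /\ m2 <> 1) ->
  exists2 m, m \in base_lengths lx ly &
    (m.1 = m1 \/ [/\ 0 < m.1, m.1 <= m1 & odd m.1 = odd m1]) /\
    (m.2 = m2 \/ [/\ 0 < m.2, m.2 <= m2 & odd m.2 = odd m2]).
Proof.
move=> odd_m m_ge3 n1 n2; rewrite /base_lengths.
have [m10|m1_gt0] := posnP m1.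
  exists (0, 3); last by split; [left|right; split=> /=; lia].
  by case: ifP n1 => [_ /(_ isT)[]|_ _]; [lia|rewrite mem_cat !inE].
have [m20|m2_gt0] := posnP m2.
  exists (3, 0); last by split; [right; split=> /=; lia|left].
  by case: ifP n1 => [_ /(_ isT)[]|_ _]; [lia|rewrite mem_cat !inE].
have [/n2[m1n1 m2n1]|_] := boolP (near2 lx ly); case odd_m1: (odd m1).
- by exists (3, 2); [rewrite mem_cat !inE eqxx !orbT|split; right; split=> /=; lia].
- by exists (2, 3); [rewrite mem_cat !inE eqxx !orbT|split; right; split=> /=; lia].
- by exists (1, 2); [rewrite mem_cat !inE eqxx !orbT|split; right; split=> /=; lia].
- by exists (2, 1); [rewrite mem_cat !inE eqxx !orbT|split; right; split=> /=; lia].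
Qed.

(** The columns of the two deleted vertices split the ring into two arcs of m1 and m2 undeleted
    columns; b is the common color of the two right semiedges other than the dock. *)
Lemma ring_coloring lx ly i j m1 m2 : i < 3 -> j < 3 -> odd (m1 + m2) -> 2 < m1 + m2 ->
  (near1 lx ly -> 0 < m1 /\ 0 < m2) -> (near2 lx ly -> m1 <> 1 /\ m2 <> 1) ->
  exists (b : nat) (st md : nat -> triple),
    [/\ b = 0 \/ b = 3, st (m1 + m2).+2 = st 0
      & forall o, o < (m1 + m2).+2 ->
        column_ok (if o == 0 then Some (lx, pattern 0 1 i)
                   else if o == m1.+1 then Some (ly, pattern 0 b j) else None)
          (st o) (md o) (st o.+1)].
Proof.
move=> i3 j3 odd_m m_ge3 n1 n2.
have [[p1 p2] p_base /= [ext1 ext2]] := base_lengthsP odd_m m_ge3 n1 n2.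
have lab l : l \in labels by case: l; rewrite !inE eqxx ?orbT.
have i_in : i \in iota 0 3 by rewrite mem_iota.
have j_in : j \in iota 0 3 by rewrite mem_iota.
have := allP (allP (allP (allP (allP base_rings_check _ (lab lx)) _ i_in) _ (lab ly)) _ j_in)
  _ p_base.
rewrite /ring_solvable -!has_find => solv.
have [b b03 /hasP[[s t] /flatten_mapP[sx _ /mapP[u s_u [-> ->]]] /=]] :
    exists2 b, b = 0 \/ b = 3 & has (fun p => reaches (nseq p1 full_column ++
      Some (ly, pattern 0 b j) :: nseq p2 full_column) p.2 p.1) (starts lx i).
  by case: ifP solv => [? _|_ ?]; [exists 0|exists 3] => //; [left|right].
case/reaches_cat=> v /(more_columns_eq ext1) uv.
rewrite reaches_cons => /hasP[w vw /(more_columns_eq ext2) ws].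
(* Column 0 is that of x, and column m1 + 1 that of y. *)
pose cs := Some (lx, pattern 0 1 i) :: nseq m1 full_column ++
  Some (ly, pattern 0 b j) :: nseq m2 full_column.
have /reaches_path[st [md [st0 stn stP]]] : reaches cs sx sx.
  rewrite reaches_cons; apply/hasP; exists u => //.
  apply/reaches_cat; exists v => //; rewrite reaches_cons; apply/hasP; by exists w.
have size_cs : size cs = (m1 + m2).+2 by rewrite /= size_cat /= !size_nseq addnS.
exists b, st, md; split=> //; first by rewrite -size_cs stn st0.
move=> o o_lt; have := stP o; rewrite size_cs => /(_ o_lt).
case: o o_lt => // o o_lt /=; rewrite eqSS nth_cat size_nseq nth_nseq.
have [lt_o|gt_o|->] := ltngtP o m1; [by []| |by rewrite subnn].
by rewrite -(subnKC gt_o) addSn -addnS addKn /= nth_nseq if_same.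
Qed.

(** * Template colorings of flower snarks *)

Lemma edge_in_nbrs (H : sgraph) (u v : H) : (v \in nbrs u) = adj u v.
Proof. by rewrite inE. Qed.

Lemma adj_neq (H : sgraph) (u v : H) : adj u v -> u != v.
Proof. by apply: contraTneq => ->; rewrite adj_irr. Qed.

Lemma set2_inj (T : finType) (u v u' v' : T) : u != v -> [set u; v] = [set u'; v'] ->
  (u = u' /\ v = v') \/ (u = v' /\ v = u').
Proof.
move=> uv e; have := set21 u v; have := set22 u v; rewrite e !inE.
by move=> /pred2P[]ev /pred2P[]eu; move: uv; rewrite ev eu ?eqxx; auto.
Qed.

(** Colorings are functions on vertex sets; this lets them be given on ordered pairs. *)
Lemma edge_coloring_of_arcs (H : sgraph) (T : Type) (t0 : T) (k : H -> H -> T) :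
  (forall u v, adj u v -> k u v = k v u) ->
  exists c : {set H} -> T, forall u v, adj u v -> c [set u; v] = k u v.
Proof.
move=> k_sym.
exists (fun S => if [pick p : H * H | adj p.1 p.2 && (S == [set p.1; p.2])] is Some p
  then k p.1 p.2 else t0) => u v uv.
case: pickP => [[u' v'] /= /andP[uv' /eqP /(set2_inj (adj_neq uv))]|/(_ (u, v))].
  by case=> [[-> ->]|[-> ->]] //; rewrite k_sym.
by rewrite /= uv eqxx.
Qed.

Lemma gdist_ge3 (H : sgraph) (u v : H) : 3 <= gdist u v ->
  [/\ u != v, ~~ adj u v & forall w, ~~ (adj u w && adj w v)].
Proof.
rewrite /gdist => far.
have no_walk n (p : n.-tuple H) : n < 3 -> path (@adj H) u p -> last u p != v.
  move=> n3 up; apply/eqP=> pv.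
  have := before_find 0 (leq_trans n3 far).
  rewrite nth_iota; last first.
    by rewrite -[#|H|](size_iota 0); apply: leq_trans n3 (leq_trans far (find_size _ _)).
  by rewrite add0n => /existsP[]; exists p; rewrite up pv eqxx.
split; first exact: (no_walk 0 [tuple]).
- by apply/negP=> uv; have := no_walk 1 [tuple v] isT; rewrite /= uv eqxx => /(_ isT).
move=> w; apply/negP=> /andP[uw wv].
by have := no_walk 2 [tuple w; v] isT; rewrite /= uw wv eqxx => /(_ isT).
Qed.

(** Here x' and y' are the ends of the left and right dock semiedges: a semiedge of H with x
    and y deleted is an edge of H at x or at y. *)
Definition template_coloring (H : sgraph) (x y x' y' : H) (c : {set H} -> nat) (b : nat) : Prop :=
  [/\ forall v : H, v != x -> v != y -> star [seq c [set v; w] | w in nbrs v],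
      forall w : H, adj x w -> c [set x; w] = if w == x' then 0 else 1
    & forall w : H, adj y w -> c [set y; w] = if w == y' then 0 else b].

Lemma star_eq s t : s =i t -> star t -> star s.
Proof. by move=> st [e|e]; [left|right] => x; rewrite st e. Qed.

Section Flower.
Variable r : nat.
Hypothesis r_ge5 : 5 <= r.

Implicit Types (i : 'I_r) (l : flower_label) (u v w : flower r).

Lemma ordS_neq i : ordS i != i.
Proof.
have lt_r := ltn_ord i; apply/eqP=> /(congr1 val) /=.
have [e|lt_i] := eqVneq i.+1 r; last by rewrite modn_small; lia.
by rewrite {1}e modnn; lia.
Qed.

Lemma ordSS_neq i : ordS (ordS i) != i.
Proof.
have lt_r := ltn_ord i; apply/eqP=> /(congr1 val) /=; rewrite -addn1 modnDml addn1.
have [lt_i|ge_i] := ltnP i.+2 r; first by rewrite modn_small; lia.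
have -> : i.+2 = i.+2 - r + r by lia.
by rewrite modnDr modn_small; lia.
Qed.

(** The order is the one of [cols_at]: entering, leaving, inside the column. *)
Definition flower_nbrs (u : flower r) : seq (flower r) :=
  let: (l, i) := u in
  match l with
  | FX => [:: (FX, ord_pred i); (FX, ordS i); (FY, i)]
  | FY => [:: (FX, i); (FZ, i); (FW, i)]
  | FZ => [:: (FW, ord_pred i); (FW, ordS i); (FY, i)]
  | FW => [:: (FZ, ord_pred i); (FZ, ordS i); (FY, i)]
  end.

Lemma eq_ordS i j : (i == ordS j) = (j == ord_pred i).
Proof. by rewrite -[in RHS](can_eq (@ordSK r)) ord_predK eq_sym. Qed.

Lemma label_eqE (l l' : flower_label) : (l == l') = same_label l l'.
Proof. exact: (sameP eqP (same_labelP l l')). Qed.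

Lemma flower_adj u v : adj u v = (v \in flower_nbrs u).
Proof.
case: u v => [l i] [l' j]; rewrite /adj /= /graph_of_rel /flower_edge /= xpair_eqE negb_and.
have nS (k : 'I_r) : (k == ordS k) = false by rewrite eq_sym (negbTE (ordS_neq k)).
case: l; case: l'; rewrite /= !inE !xpair_eqE !label_eqE /= ?orbF ?andbF //= ?(eq_ordS i j) //
  1?orbC ?(eq_sym i j) //.
by case: eqVneq => [->|] //=; rewrite -eq_ordS nS.
Qed.

(** [S i] is the state between columns i - 1 and i, and [M i] the colors inside column i. *)
Definition ring_color (S M : 'I_r -> triple) (u v : flower r) : nat :=
  match u.1, v.1 with
  | FX, FX => if v.2 == ordS u.2 then (S v.2).1.1 else (S u.2).1.1
  | FX, FY | FY, FX => (M u.2).1.1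
  | FY, FZ | FZ, FY => (M u.2).1.2
  | FY, FW | FW, FY => (M u.2).2
  | FZ, FW => if v.2 == ordS u.2 then (S v.2).1.2 else (S u.2).2
  | FW, FZ => if v.2 == ordS u.2 then (S v.2).2 else (S u.2).1.2
  | _, _ => 0
  end.

Lemma ring_color_sym S M u v : adj u v -> ring_color S M u v = ring_color S M v u.
Proof.
have nS i : (ord_pred i == ordS i) = false.
  by apply/negbTE; apply: contra_neq (ordSS_neq i) => <-; rewrite ord_predK.
have nSS i : (i == ordS (ordS i)) = false by rewrite eq_sym (negbTE (ordSS_neq i)).
rewrite flower_adj; case: u v => [l i] [l' j] /=.
by case: l; rewrite !inE => /or3P[] /eqP[-> ->];
  rewrite /ring_color /= ?nS ?nSS ?ord_predK ?eqxx.
Qed.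

Lemma ring_color_nbrs S M (l : flower_label) i :
  [seq ring_color S M (l, i) w | w <- flower_nbrs (l, i)] =
  seq3 (cols_at l (S i) (M i) (S (ordS i))).
Proof.
have nS : (ord_pred i == ordS i) = false.
  by apply/negbTE; apply: contra_neq (ordSS_neq i) => <-; rewrite ord_predK.
case eS: (S i) => [[a b] c]; case eM: (M i) => [[d e] f]; case eO: (S (ordS i)) => [[a' b'] c'].
by case: l; rewrite /= /ring_color /= ?nS ?eqxx ?eS ?eM ?eO.
Qed.

Definition close u v : Prop := adj u v \/ exists w, adj u w && adj w v.

Lemma close_sym u v : close u v -> close v u.
Proof.
case=> [uv|[w /andP[uw wv]]]; first by left; rewrite adj_sym.
by right; exists w; rewrite adj_sym wv adj_sym.
Qed.

Lemma close1 u v : v \in flower_nbrs u -> close u v.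
Proof. by rewrite -flower_adj; left. Qed.

Lemma close2 u w v : w \in flower_nbrs u -> v \in flower_nbrs w -> close u v.
Proof. by rewrite -!flower_adj => uw wv; right; exists w; rewrite uw. Qed.

Ltac in_flower_nbrs := by rewrite /= !inE ?ordSK ?eqxx ?orbT.

Lemma same_column_close (l l' : flower_label) i : close (l, i) (l', i).
Proof.
by case: l l' => [] []; (apply: close1; in_flower_nbrs)
  || (apply: (@close2 _ (FY, i)); in_flower_nbrs)
  || (apply: (@close2 _ (FX, i)); in_flower_nbrs).
Qed.

Lemma near1_close (l l' : flower_label) i : near1 l l' -> close (l, i) (l', ordS i).
Proof.
case: l l' => [] [] //= _; try (by apply: close1; in_flower_nbrs);
  [apply: (@close2 _ (FX, ordS i))|apply: (@close2 _ (FX, i))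
  |apply: (@close2 _ (FW, i))|apply: (@close2 _ (FZ, i))
  |apply: (@close2 _ (FW, ordS i))|apply: (@close2 _ (FZ, ordS i))]; in_flower_nbrs.
Qed.

Lemma near2_close (l l' : flower_label) i : near2 l l' -> close (l, i) (l', ordS (ordS i)).
Proof.
case: l l' => [] [] //= _;
  [apply: (@close2 _ (FX, ordS i))|apply: (@close2 _ (FW, ordS i))
  |apply: (@close2 _ (FZ, ordS i))]; in_flower_nbrs.
Qed.

Lemma gdist_ge3_not_close u v : 3 <= gdist u v -> u <> v /\ ~ close u v.
Proof.
case/gdist_ge3=> /eqP neq nadj nwalk; split=> // -[uv|[w uwv]]; first by rewrite uv in nadj.
by have := nwalk w; rewrite uwv.
Qed.

(** The rotation of the columns which brings i0 to 0. *)
Definition offset (i0 i : 'I_r) : nat := (i + (r - i0)) %% r.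

Lemma offset_lt i0 i : offset i0 i < r.
Proof. by rewrite ltn_mod; apply: leq_trans r_ge5. Qed.

Lemma offset_self i : offset i i = 0.
Proof. by rewrite /offset subnKC ?modnn // ltnW. Qed.

Lemma offset_ordS i0 i : offset i0 (ordS i) = (offset i0 i).+1 %% r.
Proof. by rewrite /offset /= modnDml addSn -[in RHS]addn1 modnDml addn1. Qed.

Lemma offset_inj i0 : injective (offset i0).
Proof.
move=> i j; have [/ltnW lt0 lti ltj] := And3 (ltn_ord i0) (ltn_ord i) (ltn_ord j).
move=> /eqP; rewrite /offset eqn_modDr => /eqP; rewrite !modn_small //.
exact: val_inj.
Qed.

Lemma offset_ordS_small i0 i : (offset i0 i).+1 < r -> offset i0 (ordS i) = (offset i0 i).+1.
Proof. by move=> lt_r; rewrite offset_ordS modn_small. Qed.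

Lemma nth_pattern a b n m : n < 3 -> m < 3 ->
  nth 0 (seq3 (pattern a b n)) m = if m == n then a else b.
Proof. by case: n m => [|[|[|n]]] [|[|[|m]]]. Qed.

Lemma index_flower_nbrs u v : adj u v -> index v (flower_nbrs u) < 3.
Proof.
by rewrite flower_adj -index_mem => /leq_trans; apply; case: u => [[]].
Qed.

Lemma ring_color_pattern S M u u' w a b :
  cols_at u.1 (S u.2) (M u.2) (S (ordS u.2)) = pattern a b (index u' (flower_nbrs u)) ->
  adj u u' -> adj u w -> ring_color S M u w = if w == u' then a else b.
Proof.
move=> pat uu' uw; have w_in := uw; rewrite flower_adj in w_in.
rewrite -[w in LHS](nth_index u w_in) -(nth_map _ 0) ?index_mem //.
have := ring_color_nbrs S M u.1 u.2; rewrite -surjective_pairing => ->.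
rewrite pat nth_pattern ?index_flower_nbrs //; congr (if _ then _ else _).
by apply/eqP/eqP=> [e|->] //; rewrite -(nth_index u w_in) e nth_index -?flower_adj.
Qed.

(** After rotating x to column 0, the distance hypothesis excludes exactly the pairs of labels
    which [ring_coloring] excludes when the two columns are close on one of the sides. *)
Lemma flower_template x y x' y' : odd r -> 3 <= gdist x y -> adj x x' -> adj y y' ->
  exists (c : {set flower r} -> nat) (b : nat),
    (b = 0 \/ b = 3) /\ template_coloring x y x' y' c b.
Proof.
move=> odd_r /gdist_ge3_not_close[neq far] xx' yy'.
case: x y neq far xx' yy' => [lx ix] [ly iy] neq far xx' yy'.
have lt_r := offset_lt ix iy.
have k_gt0 : 0 < offset ix iy.
  rewrite lt0n; apply/eqP; rewrite -(offset_self ix) => /offset_inj e.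
  by case: far; rewrite e; exact: same_column_close.
have wrap m i : offset ix i = r - m -> 0 < m -> m < r -> offset ix (ordS i) = (r - m.-1) %% r.
  by move=> e m0 mr; rewrite offset_ordS e; congr (_ %% _); lia.
(* On the one side y comes shortly after x, on the other side x comes shortly after y. *)
have n1 : near1 lx ly -> 0 < (offset ix iy).-1 /\ 0 < r - (offset ix iy).+1.
  move=> near; split; rewrite lt0n; apply/eqP=> e; case: far.
    suff -> : iy = ordS ix by exact: near1_close.
    by apply: (@offset_inj ix); rewrite offset_ordS_small offset_self //; lia.
  apply: close_sym; suff -> : ix = ordS iy.
    by apply: near1_close; case: (lx) (ly) near => [] [].
  by apply: (@offset_inj ix); rewrite (wrap 1) ?subn0 ?modnn ?offset_self //; lia.
have n2 : near2 lx ly -> (offset ix iy).-1 <> 1 /\ r - (offset ix iy).+1 <> 1.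
  move=> near; split=> e; case: far.
    suff -> : iy = ordS (ordS ix) by exact: near2_close.
    by apply: (@offset_inj ix); rewrite !offset_ordS_small offset_self //; lia.
  apply: close_sym; suff -> : ix = ordS (ordS iy).
    by apply: near2_close; case: (lx) (ly) near => [] [].
  apply: (@offset_inj ix); rewrite offset_ordS (wrap 2) /=; try lia.
  rewrite (@modn_small (r - 1)); last lia.
  by rewrite -subSn ?subSS ?subn0 ?modnn ?offset_self //; lia.
have sum_r : ((offset ix iy).-1 + (r - (offset ix iy).+1)).+2 = r by lia.
have := @ring_coloring lx ly _ _ _ _ (index_flower_nbrs xx') (index_flower_nbrs yy') _ _ n1 n2.
case; [lia|lia|]; move=> b [st [md []]]; rewrite sum_r prednK // => b03 st_r stP.
pose S i := st (offset ix i); pose M i := md (offset ix i).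
have S_ordS i : S (ordS i) = st (offset ix i).+1.
  rewrite /S offset_ordS; have [lt_i|] := ltnP (offset ix i).+1 r; first by rewrite modn_small.
  by move=> ge_r; have -> : (offset ix i).+1 = r; [have := offset_lt ix i; lia|rewrite modnn st_r].
have [c cP] := edge_coloring_of_arcs 0 (@ring_color_sym S M).
have col_ok i := stP _ (offset_lt ix i); rewrite -/(S _) in col_ok.
exists c, b; split=> //; split.
- move=> [l i] neq_x neq_y.
  apply: (@star_eq _ (seq3 (cols_at l (S i) (M i) (S (ordS i))))).
    move=> a; rewrite -ring_color_nbrs; apply/imageP/mapP => -[w w_in ->]; exists w.
    - by rewrite -flower_adj -edge_in_nbrs.
    - by rewrite cP // -edge_in_nbrs.
    - by rewrite edge_in_nbrs flower_adj.
    - by rewrite cP // flower_adj.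
  have := col_ok i l; rewrite -S_ordS.
  have [/eqP|_] := ifP.
    rewrite -(offset_self ix) => /offset_inj e; rewrite /vertex_ok /=.
    by case: same_labelP => // el; rewrite el e eqxx in neq_x.
  have [/eqP|_] //= := ifP.
  move=> /offset_inj e; rewrite /vertex_ok /=.
  by case: same_labelP => // el; rewrite el e eqxx in neq_y.
- move=> w xw; rewrite cP //; apply: ring_color_pattern => //.
  have := col_ok ix lx; rewrite -S_ordS.
  case: eqP => [_ /=|[]]; last exact: offset_self.
  by case: same_labelP.
- move=> w yw; rewrite cP //; apply: ring_color_pattern => //.
  have := col_ok iy ly; rewrite -S_ordS (gtn_eqF k_gt0) eqxx /=.
  by case: same_labelP.
Qed.

End Flower.

Lemma template_coloring_iso (H K : sgraph) (f : H -> K) (x y x' y' : H)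
    (c : {set K} -> nat) (b : nat) :
  graph_iso f -> template_coloring (f x) (f y) (f x') (f y') c b ->
  template_coloring x y x' y' (fun S => c (f @: S)) b.
Proof.
move=> [[g fK gK] f_adj] [c_star c_x c_y].
have f_inj := can_inj fK.
have f_edge u v : f @: [set u; v] = [set f u; f v] by rewrite imsetU1 imset_set1.
split=> [v vx vy|w xw|w yw]; last 2 first.
- by rewrite f_edge c_x ?f_adj // (inj_eq f_inj).
- by rewrite f_edge c_y ?f_adj // (inj_eq f_inj).
apply: star_eq (c_star (f v) _ _); rewrite ?(inj_eq f_inj) //.
move=> a; apply/imageP/imageP => -[w]; rewrite edge_in_nbrs => vw ->.
  by exists (f w); rewrite ?f_edge // edge_in_nbrs f_adj.
by exists (g w); rewrite ?f_edge ?gK // edge_in_nbrs -f_adj gK.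
Qed.

Lemma flower_superedge_template (B : superedge) (j k : 'I_3) : flower_superedge B ->
  exists (c : {set B} -> nat) (b : nat), (b = 0 \/ b = 3) /\
    template_coloring (se_x B) (se_y B) (se_left B j) (se_right B k) c b.
Proof.
case=> r [f [odd_r r_ge5 f_iso far]].
have f_adj u v : adj u v -> adj (f u) (f v) by rewrite f_iso.2.
have [c [b [b03 cP]]] := flower_template r_ge5 odd_r far
  (f_adj _ _ (se_left_nbr B j)) (f_adj _ _ (se_right_nbr B k)).
by exists (fun S : {set B} => c (f @: S)), b; split=> //; apply: template_coloring_iso.
Qed.

(** * Normal colorings obtained by projection *)

Lemma card_colors_at (G : sgraph) k (c : {set G} -> 'I_k) (u : G) :
  cubic G -> proper_coloring c -> #|colors_at c u| = 3.
Proof.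
move=> G_cubic c_proper; rewrite card_in_imset ?G_cubic // => v w; rewrite !edge_in_nbrs => uv uw.
by apply: contra_eq; apply: c_proper.
Qed.

(** Seeing three colors through at most three edges, a vertex sees them on distinct edges:
    hence properness. *)
Lemma normal_of_projection (G H : sgraph) (sigma : {set G} -> 'I_5) (tau : {set H} -> 'I_5)
    (f : H -> G) :
  cubic G -> normal_coloring sigma ->
  (forall s : H, #|nbrs s| <= 3) ->
  (forall s : H, colors_at tau s = colors_at sigma (f s)) ->
  (forall s t : H, adj s t -> f s = f t \/ adj (f s) (f t)) ->
  normal_coloring tau.
Proof.
move=> G_cubic sigma_normal nbrs3 colorsE f_adj.
have card3 (u : G) : #|colors_at sigma u| = 3 := card_colors_at u G_cubic sigma_normal.1.
split=> [s t t' st st'|s t st]; last first.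
  rewrite /poor /rich !colorsE; have [<-|/sigma_normal.2 //] := f_adj s t st.
  by rewrite setUid card3.
apply: contra_neq => e; move: t t' {e}(e : _ = _) st st' => t t' e.
rewrite -!edge_in_nbrs => st st'; move: t t' st st' e; apply/imset_injP.
by rewrite eqn_leq leq_imset_card -/(colors_at tau s) colorsE card3 nbrs3.
Qed.

Lemma normal_coloring_iso (H K : sgraph) (f : H -> K) (tau : {set K} -> 'I_5) :
  graph_iso f -> normal_coloring tau -> normal_coloring (fun S => tau (f @: S)).
Proof.
move=> [[g fK gK] f_adj] [tau_proper tau_pr].
have f_edge u v : f @: [set u; v] = [set f u; f v] by rewrite imsetU1 imset_set1.
have colorsE u : colors_at (fun S => tau (f @: S)) u = colors_at tau (f u).
  apply/setP=> x; apply/imsetP/imsetP => -[w]; rewrite edge_in_nbrs => uw ->.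
    by exists (f w); rewrite ?f_edge // edge_in_nbrs f_adj.
  by exists (g w); rewrite ?f_edge ?gK // edge_in_nbrs -f_adj gK.
split=> [u v w uv uw vw|u v uv].
  by rewrite !f_edge; apply: tau_proper; rewrite ?f_adj // (can_eq fK).
by rewrite /poor /rich !colorsE; apply: tau_pr; rewrite f_adj.
Qed.

(** * The edges of a superposition *)

Section Joints.
Variables (G : sgraph) (C : rel G) (D : superposition_data C).
Hypothesis C_even : even_subgraph C.

Local Notation on := (on_subgraph C).
Local Notation next := (sp_next D).
Local Notation prev := (sp_prev D).
Local Notation base := (sp_base D).
Local Notation inner := (@sp_inner G C D _).
Local Notation new := (sp_new D).

Lemma prev_next u : prev (next u) = u.
Proof. by rewrite /sp_prev permK. Qed.

Lemma next_prev u : next (prev u) = u.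
Proof. by rewrite /sp_prev permKV. Qed.

Lemma onE u : on u = (next u != u).
Proof.
apply/existsP/idP => [[v]|nu]; last by exists (next u); rewrite (sp_nextP D) eq_sym nu eqxx.
rewrite (sp_nextP D) => /andP[uv /orP[/eqP <-|/eqP uE]]; first by rewrite eq_sym.
by apply: contra uv => /eqP nu; apply/eqP; apply: (@perm_inj _ next); rewrite nu.
Qed.

Lemma on_next u : on (next u) = on u.
Proof. by rewrite !onE (inj_eq perm_inj). Qed.

Lemma on_prev u : on (prev u) = on u.
Proof. by rewrite -on_next next_prev. Qed.

Lemma subgraph_edge u v : on u -> C u v = (v == next u) || (v == prev u).
Proof.
move=> u_on; have p_neq : prev u != u by rewrite -(inj_eq (@perm_inj _ next)) next_prev eq_sym -onE.
have pE v' : (u == next v') = (v' == prev u).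
  by rewrite -[in RHS](inj_eq (@perm_inj _ next)) next_prev eq_sym.
rewrite (sp_nextP D) pE; have [<-|//] := eqVneq u v.
by rewrite !(eq_sym u) (negbTE p_neq) -[next u == u]negbK -onE u_on.
Qed.

(** This is where the degrees in C being even is used: if both neighbors on the cycle
    coincided, u would have degree 1 in C. *)
Lemma next_neq_prev u : on u -> next u != prev u.
Proof.
move=> u_on; have [_ _ /(_ u)] := C_even; apply: contraNneq => np.
have -> : [set v | C u v] = [set next u].
  by apply/setP=> v; rewrite !inE subgraph_edge // -np orbb.
by rewrite cards1.
Qed.

Lemma adj_next u : on u -> adj u (next u).
Proof. by case: C_even => _ sub _ u_on; apply: sub; rewrite subgraph_edge // eqxx. Qed.

Lemma adj_prev u : on u -> adj u (prev u).
Proof. by case: C_even => _ sub _ u_on; apply: sub; rewrite subgraph_edge // eqxx orbT. Qed.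

(** The edges of the superposition, each listed in one direction. The right semiedge i of the
    superedge at u goes to the joint at [next u], where its index is [sp_p D u i]; writing
    joints in this way avoids transporting vertices along [sp_next D (sp_prev D u) = u]. *)
Inductive link : sp_prevertex D -> sp_prevertex D -> Prop :=
| LinkOld u v of adj u v & ~~ C u v : link (base u) (base v)
| LinkInner u (a b : sp_B D u) of adj a b : link (inner a) (inner b)
| LinkNew u j k of j != k : link (new u j) (new u k)
| LinkDockLeft u of on u :
    link (base u) (inner (se_left (sp_B D u) (sp_d D u)))
| LinkDockRight u i of on u & sp_p D u i = sp_d D (next u) :
    link (base (next u)) (inner (se_right (sp_B D u) i))
| LinkNewLeft u j of on u & sp_A D u = SvA' & j != sp_d D u :
    link (new u j) (inner (se_left (sp_B D u) j))
| LinkNewRight u i of on u & sp_A D (next u) = SvA' & sp_p D u i != sp_d D (next u) :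
    link (new (next u) (sp_p D u i)) (inner (se_right (sp_B D u) i))
| LinkJoin u i of on u & sp_A D (next u) = SvA & sp_p D u i != sp_d D (next u) :
    link (inner (se_right (sp_B D u) i)) (inner (se_left (sp_B D (next u)) (sp_p D u i))).

Lemma right_end_next u j :
  sp_right_end D (next u) j = inner (se_right (sp_B D u) (((sp_p D u)^-1)%g j)).
Proof. by rewrite /sp_right_end prev_next. Qed.

Lemma sp_edge_link s t : sp_edge s t -> link s t.
Proof.
case/or3P.
- case: s t => [[u|[u a]]|[u j]] [[v|[v b]]|[v k]] //=; first by case/andP; constructor.
  case/andP=> /eqP uv; rewrite -uv in b *; rewrite tagged_asE; exact: LinkInner.
- case: s t => [[u|[u a]]|[u j]] [[v|[v b]]|[v k]] //=.
  by case/andP=> /eqP <-; exact: LinkNew.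
case/existsP=> u /andP[]; rewrite -(next_prev u) on_next.
set w := prev u => w_on /existsP[j].
have [i ->] : exists i, j = sp_p D w i by exists (((sp_p D w)^-1)%g j); rewrite permKV.
rewrite /sp_joined /sp_subdivider right_end_next permK /sp_left_end.
have nw_on : on (next w) by rewrite on_next.
have [e|ne] := eqVneq.
  case/andP=> /eqP -> /orP[] /eqP ->; first exact: LinkDockRight.
  by rewrite e; exact: LinkDockLeft.
case eA: (sp_A D (next w)) => /andP[/eqP ->].
  by move=> /eqP ->; exact: LinkJoin.
by case/orP=> /eqP ->; [apply: LinkNewRight|apply: LinkNewLeft].
Qed.

Lemma link_sp_edge s t : link s t -> sp_edge s t.
Proof.
have joint u j : on u -> sp_joined u j s t -> sp_edge s t.
  move=> u_on st; apply/or3P/Or33; apply/existsP; exists u; rewrite u_on.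
  by apply/existsP; exists j.
move=> st; case: st joint.
- by move=> u v uv nC _; rewrite /sp_edge /= uv nC.
- by move=> u a b ab _; rewrite /sp_edge /= eqxx tagged_asE ab.
- by move=> u j k jk _; rewrite /sp_edge /= eqxx jk.
- move=> u u_on /(_ u (sp_d D u) u_on); apply.
  by rewrite /sp_joined /sp_subdivider /sp_left_end !eqxx orbT.
- move=> u i u_on e; rewrite -on_next in u_on; move/(_ _ (sp_d D (next u)) u_on); apply.
  by rewrite /sp_joined /sp_subdivider right_end_next !eqxx -e permK eqxx.
- move=> u j u_on eA ne /(_ u j u_on); apply.
  by rewrite /sp_joined /sp_subdivider (negbTE ne) eA /sp_left_end !eqxx orbT.
- move=> u i u_on eA ne; rewrite -on_next in u_on; move/(_ _ (sp_p D u i) u_on); apply.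
  by rewrite /sp_joined /sp_subdivider (negbTE ne) eA right_end_next permK !eqxx.
- move=> u i u_on eA ne; rewrite -on_next in u_on; move/(_ _ (sp_p D u i) u_on); apply.
  by rewrite /sp_joined /sp_subdivider (negbTE ne) eA right_end_next permK !eqxx.
Qed.

Lemma sp_edgeP s t : reflect (link s t) (sp_edge s t).
Proof. by apply: (iffP idP); [apply: sp_edge_link|apply: link_sp_edge]. Qed.

(** * The coloring of a superposition *)

Section Coloring.
Variable sigma : {set G} -> 'I_5.
Hypotheses (G_cubic : cubic G) (sigma_normal : normal_coloring sigma).
Variables (tmpl : forall u, {set sp_B D u} -> nat) (tail : G -> nat).
Arguments tmpl : clear implicits.

Definition next_color u := sigma [set u; next u].
Definition prev_color u := next_color (prev u).
(** The color of the edge at u off the cycle, as the color at u different from the two cycle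
    edges. *)
Definition spoke_color u :=
  odflt ord0 [pick x in colors_at sigma u :\: [set prev_color u; next_color u]].

(** The common color of the two free right semiedges joined at u. *)
Definition arriving_color u := if tail (prev u) == 0 then prev_color u else spoke_color u.
Definition remaining_color u := if tail (prev u) == 0 then spoke_color u else prev_color u.
(** The color of the two free left semiedges at u: the one which arrives if they are joined
    directly, and a different one if a new vertex lies in between. *)
Definition leaving_color u := if sp_A D u is SvA then arriving_color u else remaining_color u.
Definition inner_color u := if sp_A D u is SvA then remaining_color u else arriving_color u.

(** The meaning of the template colors in the superedge replacing the edge from u to [next u]. *)
Definition paint u : nat -> 'I_5 :=
  nth ord0 [:: next_color u; leaving_color u; inner_color u; spoke_color (next u);
    next_color (next u)].

Lemma prev_color_next u : prev_color (next u) = next_color u.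
Proof. by rewrite /prev_color prev_next. Qed.

Lemma edge_color_in u v : adj u v -> sigma [set u; v] \in colors_at sigma u.
Proof. by move=> uv; apply: imset_f; rewrite edge_in_nbrs. Qed.

Lemma next_color_in u : on u -> next_color u \in colors_at sigma u.
Proof. by move=> u_on; apply/edge_color_in/adj_next. Qed.

Lemma prev_colorE u : prev_color u = sigma [set u; prev u].
Proof. by rewrite /prev_color /next_color next_prev setUC. Qed.

Lemma prev_color_in u : on u -> prev_color u \in colors_at sigma u.
Proof. by move=> u_on; rewrite prev_colorE; apply/edge_color_in/adj_prev. Qed.

Lemma prev_color_neq_next u : on u -> prev_color u != next_color u.
Proof.
move=> u_on; rewrite prev_colorE; apply: sigma_normal.1; [exact: adj_prev|exact: adj_next|].
by rewrite eq_sym next_neq_prev.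
Qed.

Lemma colors_at_on u : on u -> colors_at sigma u = [set prev_color u; next_color u; spoke_color u].
Proof.
move=> u_on.
have sub : [set prev_color u; next_color u] \subset colors_at sigma u.
  by apply/subsetP=> x; rewrite !inE => /pred2P[] ->; [apply: prev_color_in|apply: next_color_in].
have card1 : #|colors_at sigma u :\: [set prev_color u; next_color u]| == 1.
  rewrite cardsD (setIidPr sub) (card_colors_at _ G_cubic sigma_normal.1) cards2.
  by rewrite prev_color_neq_next.
have [x xP] := cards1P card1.
have -> : spoke_color u = x.
  by rewrite /spoke_color; case: pickP => [y|/(_ x)]; rewrite xP !inE ?eqxx // => /eqP.
by rewrite -xP -{1}(setID (colors_at sigma u) [set prev_color u; next_color u]) (setIidPr sub).
Qed.

Lemma paint012 u : on u -> [seq paint u i | i <- [:: 0; 1; 2]] =i colors_at sigma u.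
Proof.
move=> u_on x; rewrite colors_at_on // !inE /paint /=.
rewrite /leaving_color /inner_color /arriving_color /remaining_color.
by case: (sp_A D u); case: ifP => _;
  case: (x == prev_color u); case: (x == next_color u); case: (x == spoke_color u).
Qed.

Lemma paint034 u : on u -> [seq paint u i | i <- [:: 0; 3; 4]] =i colors_at sigma (next u).
Proof.
move=> u_on x; rewrite colors_at_on ?on_next // !inE /paint /= prev_color_next.
by case: (x == next_color u); case: (x == spoke_color (next u)); case: (x == next_color (next u)).
Qed.

(** Two adjacent inner vertices in different superedges belong to a direct joint, located at
    the later of the two cycle vertices. *)
Definition arc_color (s t : sp_prevertex D) : 'I_5 :=
  match s, t with
  | inl (inl u), inl (inl v) => sigma [set u; v]
  | inl (inl _), inl (inr q) | inl (inr q), inl (inl _) => next_color (tag q)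
  | inl (inr q), inl (inr q') =>
      if tag q == tag q' then paint (tag q) (tmpl (tag q) [set tagged q; tagged_as q q'])
      else if tag q' == next (tag q) then arriving_color (tag q') else arriving_color (tag q)
  | inl (inr q), inr (u, _) | inr (u, _), inl (inr q) =>
      if tag q == u then leaving_color u else arriving_color u
  | inr (u, _), inr _ => next_color u
  | _, _ => ord0
  end.

(** Template color 1 tells a vertex which sees {0, 1, 2}, hence the colors at u after painting,
    from one which sees {0, 3, 4}, hence the colors at [next u]. *)
Definition proj (s : sp_prevertex D) : G :=
  match s with
  | inl (inl u) | inr (u, _) => u
  | inl (inr q) =>
      if 1 \in [seq tmpl (tag q) [set tagged q; a] | a in nbrs (tagged q)] then tag q
      else next (tag q)
  end.

Hypothesis tail03 : forall u, on u -> tail u = 0 \/ tail u = 3.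
Hypothesis tmplP : forall u, on u ->
  template_coloring (se_x (sp_B D u)) (se_y (sp_B D u)) (se_left (sp_B D u) (sp_d D u))
    (se_right (sp_B D u) (((sp_p D u)^-1)%g (sp_d D (next u)))) (tmpl u) (tail u).

Lemma arc_color_inner u (a a' : sp_B D u) :
  arc_color (inner a) (inner a') = paint u (tmpl u [set a; a']).
Proof. by rewrite /= eqxx tagged_asE. Qed.

Lemma next_neq u : on u -> (next u == u) = false.
Proof. by rewrite onE => /negbTE. Qed.

Lemma nextnext_neq u : on u -> (next (next u) == u) = false.
Proof.
move=> u_on; apply/negbTE; apply: contra (next_neq_prev u_on) => /eqP e.
by rewrite -{2}e prev_next.
Qed.

Lemma arc_color_sym s t : link s t -> arc_color s t = arc_color t s.
Proof.
case=> //.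
- by move=> u v _ _ /=; rewrite setUC.
- by move=> u a a' _; rewrite !arc_color_inner setUC.
move=> u i u_on _ _ /=.
by rewrite (next_neq u_on) eq_sym (next_neq u_on) eqxx eq_sym nextnext_neq.
Qed.

Lemma proj_inner u (a : sp_B D u) : proj (inner a) = u \/ proj (inner a) = next u.
Proof. by rewrite /=; case: ifP => _; [left|right]. Qed.

Lemma proj_left u j : on u -> j != sp_d D u -> proj (inner (se_left (sp_B D u) j)) = u.
Proof.
move=> u_on ne /=; case: ifP => // /negP[].
apply/imageP; exists (se_x (sp_B D u)); first by rewrite edge_in_nbrs adj_sym se_left_nbr.
have [_ cx _] := tmplP u_on.
by rewrite setUC cx ?se_left_nbr // (inj_eq (@se_left_inj _)) (negbTE ne).
Qed.

(** Only a direct joint needs an argument: its right end may lie over either end of its cycle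
    edge, but its left end is incident to an edge of template color 1, so that it lies over the
    cycle vertex of the joint. *)
Lemma proj_link s t : sp_valid s -> link s t -> proj s = proj t \/ adj (proj s) (proj t).
Proof.
have fine u x y : on u -> x = u \/ x = next u -> y = u \/ y = next u -> x = y \/ adj x y.
  by move=> /adj_next un [] -> [] ->; rewrite ?un; auto; right; rewrite adj_sym.
move=> vs st; case: st vs => //.
- by move=> u v uv _ _; right.
- by move=> u a a' _ /= /and3P[u_on _ _]; apply: (fine u) => //; apply: proj_inner.
- by move=> u j k _ _; left.
- by move=> u u_on _; apply: (fine u) => //; [left|apply: proj_inner].
- by move=> u i u_on _ _; apply: (fine u) => //; [right|apply: proj_inner].
- by move=> u j u_on _ _ _; apply: (fine u) => //; [left|apply: proj_inner].
- by move=> u i u_on _ _ _; apply: (fine u) => //; [right|apply: proj_inner].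
- move=> u i u_on _ ne _; apply: (fine u) => //; first exact: proj_inner.
  by rewrite proj_left ?on_next //; right.
Qed.

Lemma link_neq s t : link s t -> s != t.
Proof.
have neq : s = t -> ~ link s t; last first.
  by move=> st; apply/eqP=> /neq.
move=> + st; case: st => //.
- by move=> u v uv _ [e]; rewrite e adj_irr in uv.
- move=> u a a' aa' [] /eqP; rewrite eq_Tagged /= => /eqP e; by rewrite e adj_irr in aa'.
- by move=> u j k jk [] e; rewrite e eqxx in jk.
move=> u i u_on _ _ [] e _; by have := next_neq u_on; rewrite -e eqxx.
Qed.

Definition linked s t := link s t \/ link t s.

(** What [normal_of_projection] needs at a vertex, with the neighbors listed explicitly. *)
Definition local_star s : Prop := exists l : seq (sp_prevertex D),
  [/\ size l <= 3,
      forall t, t \in l -> sp_valid t /\ linked s t,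
      forall t, sp_valid t -> linked s t -> t \in l
    & [seq arc_color s t | t <- l] =i colors_at sigma (proj s)].

Lemma size_enum_nbrs (H : sgraph) (v : H) : cubic H -> size (enum (nbrs v)) = 3.
Proof. by move=> Hc; rewrite -cardE. Qed.

Lemma se_cubic (B : superedge) : cubic B.
Proof. by case: (se_snark B). Qed.

Lemma three_nbrs_surj (H : sgraph) (v a : H) (f : 'I_3 -> H) :
  cubic H -> injective f -> (forall j, adj v (f j)) -> adj v a -> exists j, a = f j.
Proof.
move=> Hc f_inj vf va.
have /eqP e : [set f j | j : 'I_3] == nbrs v.
  rewrite eqEcard card_imset // card_ord Hc leqnn andbT.
  by apply/subsetP=> _ /imsetP[j _ ->]; rewrite edge_in_nbrs.
have : a \in nbrs v by rewrite edge_in_nbrs.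
by rewrite -e => /imsetP[j _ ->]; exists j.
Qed.

Lemma valid_left u j : on u -> sp_valid (inner (se_left (sp_B D u) j)).
Proof.
move=> u_on; rewrite /= u_on /= eq_sym (adj_neq (se_left_nbr _ j)) /=.
by apply: contraNneq (se_nonadj (sp_B D u)) => <-; exact: se_left_nbr.
Qed.

Lemma valid_right u i : on u -> sp_valid (inner (se_right (sp_B D u) i)).
Proof.
move=> u_on; rewrite /= u_on /= andbC eq_sym (adj_neq (se_right_nbr _ i)) /=.
by apply: contraNneq (se_nonadj (sp_B D u)) => <-; rewrite adj_sym; exact: se_right_nbr.
Qed.

Lemma link_dock_right u : on u ->
  link (base u) (inner (se_right (sp_B D (prev u)) (((sp_p D (prev u))^-1)%g (sp_d D u)))).
Proof.
rewrite -on_prev => u_on.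
by have := @LinkDockRight (prev u) _ u_on _; rewrite next_prev; apply; rewrite permKV.
Qed.

(** The edges at u in the superposition correspond to the edges at u in G: a cycle edge becomes
    the dock edge to the superedge replacing it. *)
Definition base_nbr u v : sp_prevertex D :=
  if C u v then
    if v == next u then inner (se_left (sp_B D u) (sp_d D u))
    else inner (se_right (sp_B D (prev u)) (((sp_p D (prev u))^-1)%g (sp_d D u)))
  else base v.

Lemma subgraph_on u v : C u v -> on u.
Proof. by move=> uv; apply/existsP; exists v. Qed.

Lemma local_star_base u : local_star (base u).
Proof.
exists [seq base_nbr u v | v <- enum (nbrs u)]; split.
- by rewrite size_map size_enum_nbrs.
- move=> _ /mapP[v + ->]; rewrite mem_enum edge_in_nbrs /base_nbr => uv.
  case: ifP => [Cuv|/negbT nC]; last by split=> //; left; constructor.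
  have u_on := subgraph_on Cuv.
  case: ifP => _; first by split; [apply: valid_left|left; constructor].
  by split; [apply: valid_right; rewrite on_prev|left; apply: link_dock_right].
- move=> t _ ut; apply/mapP.
  suff [v uv ->] : exists2 v, adj u v & t = base_nbr u v.
    by exists v => //; rewrite mem_enum edge_in_nbrs.
  case: ut; move es: (base u) => s st; case: st es => //.
  + by move=> u' v uv nC [->]; exists v => //; rewrite /base_nbr (negbTE nC).
  + move=> u' u_on [->]; exists (next u'); first exact: adj_next.
    by rewrite /base_nbr subgraph_edge ?eqxx.
  + move=> w i w_on e [->]; exists w.
      by rewrite adj_sym; exact: adj_next.
    rewrite /base_nbr subgraph_edge ?on_next // prev_next eqxx orbT.
    by rewrite eq_sym nextnext_neq // -e permK.
  + move=> v u' uv nC [->]; exists v; first by rewrite adj_sym.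
    by have [C_sym _ _] := C_even; rewrite /base_nbr C_sym (negbTE nC).
- have colE v : arc_color (base u) (base_nbr u v) = sigma [set u; v].
    rewrite /base_nbr; case: ifP => // Cuv; have u_on := subgraph_on Cuv.
    move: Cuv; rewrite subgraph_edge //; case: eqP => [-> //|_ /= /eqP ->].
    by rewrite -prev_colorE.
  rewrite -map_comp (eq_map (colE : _ =1 _)) => x.
  by apply/mapP/imsetP=> -[v v_in ->]; exists v; rewrite ?mem_enum // -mem_enum.
Qed.

Definition left_nbr u (a : sp_B D u) : sp_prevertex D :=
  if [pick j | se_left (sp_B D u) j == a] is Some j then
    if j == sp_d D u then base u
    else if sp_A D u is SvA then
      inner (se_right (sp_B D (prev u)) (((sp_p D (prev u))^-1)%g j))
    else new u j
  else base u.

Definition right_nbr u (a : sp_B D u) : sp_prevertex D :=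
  if [pick i | se_right (sp_B D u) i == a] is Some i then
    let j := sp_p D u i in
    if j == sp_d D (next u) then base (next u)
    else if sp_A D (next u) is SvA then inner (se_left (sp_B D (next u)) j)
    else new (next u) j
  else base u.

(** The edges at a in the superposition correspond to the edges at a in the superedge graph: an
    edge to a deleted vertex becomes the edge formed by its semiedge. *)
Definition inner_nbr u (a a' : sp_B D u) : sp_prevertex D :=
  if a' == se_x (sp_B D u) then left_nbr a
  else if a' == se_y (sp_B D u) then right_nbr a else inner a'.

Lemma left_nbrE u j : left_nbr (se_left (sp_B D u) j) =
    if j == sp_d D u then base u
    else if sp_A D u is SvA then
      inner (se_right (sp_B D (prev u)) (((sp_p D (prev u))^-1)%g j))
    else new u j.
Proof.
rewrite /left_nbr; case: pickP => [j' /eqP /se_left_inj -> //|/(_ j)].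
by rewrite eqxx.
Qed.

Lemma right_nbrE u i : right_nbr (se_right (sp_B D u) i) =
    let j := sp_p D u i in
    if j == sp_d D (next u) then base (next u)
    else if sp_A D (next u) is SvA then inner (se_left (sp_B D (next u)) j)
    else new (next u) j.
Proof.
rewrite /right_nbr; case: pickP => [j' /eqP /se_right_inj -> //|/(_ i)].
by rewrite eqxx.
Qed.

Lemma left_nbr_linked u j : on u ->
  sp_valid (left_nbr (se_left (sp_B D u) j)) /\
  linked (inner (se_left (sp_B D u) j)) (left_nbr (se_left (sp_B D u) j)).
Proof.
move=> u_on; rewrite left_nbrE; case: eqVneq => [->|ne].
  by split=> //; right; constructor.
case eA: (sp_A D u); last first.
  by split; [rewrite /= u_on eA|right; constructor].
split; first by apply: valid_right; rewrite on_prev.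
have := @LinkJoin (prev u) (((sp_p D (prev u))^-1)%g j).
rewrite permKV on_prev => lnk; right; move: lnk; rewrite /linked.
by rewrite next_prev; apply.
Qed.

Lemma right_nbr_linked u i : on u ->
  sp_valid (right_nbr (se_right (sp_B D u) i)) /\
  linked (inner (se_right (sp_B D u) i)) (right_nbr (se_right (sp_B D u) i)).
Proof.
move=> u_on; rewrite right_nbrE /=; case: eqVneq => [e|ne].
  by split=> //; right; constructor.
case eA: (sp_A D (next u)).
  by split; [apply: valid_left; rewrite on_next|left; constructor].
by split; [rewrite /= on_next u_on eA|right; constructor].
Qed.

Lemma inner_inj u (a a' : sp_B D u) : inner a = inner a' -> a = a'.
Proof. by case=> /eqP; rewrite eq_Tagged => /eqP. Qed.

Lemma inner_tag u u' (a : sp_B D u) (a' : sp_B D u') : inner a = inner a' -> u = u'.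
Proof. by case. Qed.

Lemma inner_nbr_x u (a : sp_B D u) : inner_nbr a (se_x (sp_B D u)) = left_nbr a.
Proof. by rewrite /inner_nbr eqxx. Qed.

Lemma inner_nbr_y u (a : sp_B D u) : inner_nbr a (se_y (sp_B D u)) = right_nbr a.
Proof. by rewrite /inner_nbr eq_sym (negbTE (se_neq _)) eqxx. Qed.

Lemma inner_nbr_complete u (a : sp_B D u) t : sp_valid t -> linked (inner a) t ->
  exists2 a', adj a a' & t = inner_nbr a a'.
Proof.
have inner_case u' (a1 a2 : sp_B D u') : sp_valid (inner a2) -> adj a1 a2 ->
    exists2 a', adj a1 a' & inner a2 = inner_nbr a1 a'.
  move=> /= /and3P[_ /negbTE nx /negbTE ny] aa; exists a2 => //.
  by rewrite /inner_nbr nx ny.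
move=> vt [|]; move es: (inner a) => s st; case: st es vt => //.
- move=> u' a1 a2 aa es vt; have e := inner_tag es; subst u'.
  by rewrite (inner_inj es); apply: inner_case.
- move=> w i w_on eA ne es vt; have e := inner_tag es; subst w.
  rewrite (inner_inj es); exists (se_y (sp_B D u)); first by rewrite adj_sym se_right_nbr.
  by rewrite inner_nbr_y right_nbrE /= (negbTE ne) eA.
- move=> u' a1 a2 aa es vt; have e := inner_tag es; subst u'.
  by rewrite (inner_inj es); apply: inner_case => //; rewrite adj_sym.
- move=> w w_on es vt; have e := inner_tag es; subst w.
  rewrite (inner_inj es); exists (se_x (sp_B D u)); first by rewrite adj_sym se_left_nbr.
  by rewrite inner_nbr_x left_nbrE eqxx.
- move=> w i w_on e1 es vt; have e := inner_tag es; subst w.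
  rewrite (inner_inj es); exists (se_y (sp_B D u)); first by rewrite adj_sym se_right_nbr.
  by rewrite inner_nbr_y right_nbrE /= e1 eqxx.
- move=> w j w_on eA ne es vt; have e := inner_tag es; subst w.
  rewrite (inner_inj es); exists (se_x (sp_B D u)); first by rewrite adj_sym se_left_nbr.
  by rewrite inner_nbr_x left_nbrE (negbTE ne) eA.
- move=> w i w_on eA ne es vt; have e := inner_tag es; subst w.
  rewrite (inner_inj es); exists (se_y (sp_B D u)); first by rewrite adj_sym se_right_nbr.
  by rewrite inner_nbr_y right_nbrE /= (negbTE ne) eA.
- move=> w i w_on eA ne es vt; have e := inner_tag es; subst u.
  rewrite (inner_inj es); exists (se_x (sp_B D (next w))); first by rewrite adj_sym se_left_nbr.
  by rewrite inner_nbr_x left_nbrE (negbTE ne) eA prev_next permK.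
Qed.

Lemma color_left_nbr u j : on u ->
  arc_color (inner (se_left (sp_B D u) j)) (left_nbr (se_left (sp_B D u) j)) =
  paint u (tmpl u [set se_left (sp_B D u) j; se_x (sp_B D u)]).
Proof.
move=> u_on; have [_ cx _] := tmplP u_on.
rewrite setUC cx ?se_left_nbr // (inj_eq (@se_left_inj _)) left_nbrE.
case: eqVneq => [_ //|ne]; rewrite /paint /leaving_color /=.
case eA: (sp_A D u) => /=; last by rewrite eqxx /leaving_color eA.
have pu : prev u != u by rewrite -{2}(next_prev u) eq_sym -onE on_prev.
by rewrite eq_sym (negbTE pu) eq_sym (negbTE (next_neq_prev u_on)).
Qed.

Lemma arriving_color_next u : on u -> paint u (tail u) = arriving_color (next u).
Proof.
by move=> u_on; rewrite /arriving_color prev_next prev_color_next; case: (tail03 u_on) => ->.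
Qed.

Lemma color_right_nbr u i : on u ->
  arc_color (inner (se_right (sp_B D u) i)) (right_nbr (se_right (sp_B D u) i)) =
  paint u (tmpl u [set se_right (sp_B D u) i; se_y (sp_B D u)]).
Proof.
move=> u_on; have [_ _ cy] := tmplP u_on.
rewrite setUC cy ?se_right_nbr // (inj_eq (@se_right_inj _)) right_nbrE /=.
have -> : (i == ((sp_p D u)^-1)%g (sp_d D (next u))) = (sp_p D u i == sp_d D (next u)).
  by rewrite -[LHS](inj_eq (@perm_inj _ (sp_p D u))) permKV.
case: eqVneq => [_ //|ne]; rewrite arriving_color_next //.
by case: (sp_A D _) => /=; rewrite (eq_sym u) next_neq // eqxx.
Qed.

Lemma right_surj u (a : sp_B D u) : adj a (se_y (sp_B D u)) ->
  exists i, a = se_right (sp_B D u) i.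
Proof.
rewrite adj_sym; apply: three_nbrs_surj; [exact: se_cubic|exact: se_right_inj|exact: se_right_nbr].
Qed.

Lemma left_surj u (a : sp_B D u) : adj a (se_x (sp_B D u)) ->
  exists i, a = se_left (sp_B D u) i.
Proof.
rewrite adj_sym; apply: three_nbrs_surj; [exact: se_cubic|exact: se_left_inj|exact: se_left_nbr].
Qed.

Lemma inner_nbr_linked u (a a' : sp_B D u) : sp_valid (inner a) -> adj a a' ->
  [/\ sp_valid (inner_nbr a a'), linked (inner a) (inner_nbr a a')
    & arc_color (inner a) (inner_nbr a a') = paint u (tmpl u [set a; a'])].
Proof.
move=> /and3P[/= u_on nx ny] aa'.
rewrite /inner_nbr; case: eqVneq => [e|ne_x].
  rewrite e in aa' *; have [j ->] := left_surj aa'.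
  by have [v l] := left_nbr_linked j u_on; split=> //; apply: color_left_nbr.
case: eqVneq => [e|ne_y].
  rewrite e in aa' *; have [j ->] := right_surj aa'.
  by have [v l] := right_nbr_linked j u_on; split=> //; apply: color_right_nbr.
split; [by rewrite /= u_on ne_x ne_y|by left; constructor|exact: arc_color_inner].
Qed.

Lemma local_star_inner u (a : sp_B D u) : sp_valid (inner a) -> local_star (inner a).
Proof.
move=> va; exists [seq inner_nbr a a' | a' <- enum (nbrs a)]; split.
- by rewrite size_map size_enum_nbrs //; apply: se_cubic.
- move=> _ /mapP[a' + ->]; rewrite mem_enum edge_in_nbrs => aa'.
  by have [] := inner_nbr_linked va aa'.
- move=> t vt /(inner_nbr_complete vt)[a' aa' ->]; apply: map_f.
  by rewrite mem_enum edge_in_nbrs.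
rewrite -map_comp.
have -> : [seq (arc_color (inner a) \o inner_nbr a) i | i <- enum (nbrs a)] =
    [seq paint u i | i <- [seq tmpl u [set a; a'] | a' in nbrs a]].
  rewrite -map_comp; apply/eq_in_map => a' /=; rewrite mem_enum edge_in_nbrs => aa'.
  by have [] := inner_nbr_linked va aa'.
have /and3P[/= u_on nx ny] := va.
have [cs _ _] := tmplP u_on; have star_a := cs a nx ny.
rewrite /proj /=; case: star_a => cE; rewrite (cE 1) /= => x.
  by rewrite -paint012 //; apply: eq_mem_map.
by rewrite -paint034 //; apply: eq_mem_map.
Qed.

Lemma third_index (j d : 'I_3) : j != d ->
  exists k, forall k', (k' == k) = (k' != j) && (k' != d).
Proof.
move=> ne; have : #|~: [set j; d]| == 1 by rewrite cardsCs setCK cards2 ne card_ord.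
case/cards1P=> k /setP kP; exists k => k'.
by have := kP k'; rewrite !inE negb_or => ->.
Qed.

Lemma link_new_right u j : on u -> sp_A D u = SvA' -> j != sp_d D u ->
  link (new u j) (inner (se_right (sp_B D (prev u)) (((sp_p D (prev u))^-1)%g j))).
Proof.
rewrite -on_prev => pu_on.
have := @LinkNewRight (prev u) (((sp_p D (prev u))^-1)%g j) pu_on.
by rewrite permKV next_prev; apply.
Qed.

(** The edge between the two new vertices has the color of the edge of C leaving u, and the two
    others have the two remaining colors at u. *)
Lemma local_star_new u j : sp_valid (new u j) -> local_star (new u j).
Proof.
move=> /= /and3P[u_on]; case eA: (sp_A D u) => // _ ne.
(* The other new vertex at u: its index is neither j nor the dock index. *)
have [k kP] := third_index ne.
have /andP[kj kd] : (k != j) && (k != sp_d D u) by rewrite -kP.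
have pu_on : on (prev u) by rewrite on_prev.
pose i := ((sp_p D (prev u))^-1)%g j.
exists [:: new u k; inner (se_left (sp_B D u) j); inner (se_right (sp_B D (prev u)) i)]; split=> //.
- move=> t; rewrite !inE => /or3P[] /eqP ->.
  + by split; [rewrite /= u_on eA kd|left; constructor; rewrite eq_sym].
  + by split; [apply: valid_left|left; constructor].
  + by split; [exact: valid_right|left; apply: link_new_right].
- move=> t vt ut; rewrite !inE.
  case: ut; move es: (new u j) => s st; case: st es vt => //.
  + move=> u' j' k' jk [<- ej] /= /and3P[_ _ k'd]; rewrite -ej in jk.
    have /eqP -> : k' == k by rewrite kP k'd eq_sym jk.
    by rewrite eqxx.
  + by move=> u' j' _ _ _ [<- <-] _; rewrite eqxx orbT.
  + move=> w i' _ _ _ [ew ej] _.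
    by rewrite /i ej ew prev_next permK eqxx !orbT.
  + move=> u' j' k' jk [<- ej] /= /and3P[_ _ k'd]; rewrite -ej in jk.
    have /eqP -> : j' == k by rewrite kP k'd jk.
    by rewrite eqxx.
- move=> x; rewrite colors_at_on // /= !inE eqxx /leaving_color eA.
  have -> : (prev u == u) = false by rewrite -{2}(next_prev u) eq_sym next_neq.
  rewrite /arriving_color /remaining_color; case: ifP => _;
  by case: (x == prev_color u); case: (x == next_color u); case: (x == spoke_color u).
Qed.

Lemma local_star_valid s : sp_valid s -> local_star s.
Proof.
case: s => [[u|[u a]]|[u j]] vs.
- exact: local_star_base.
- exact: local_star_inner.
- exact: local_star_new.
Qed.

Lemma superposed_adj (s t : superposed D) : adj s t <-> linked (val s) (val t).
Proof.
rewrite /= /graph_of_rel; split.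
  by case/andP=> _ /orP[] /sp_edgeP st; [left|right].
case=> st; rewrite -val_eqE; have := link_neq st; move/sp_edgeP: st => ->.
  by move=> ->.
by rewrite eq_sym orbT => ->.
Qed.

Lemma superposed_normal : exists tau : {set superposed D} -> 'I_5, normal_coloring tau.
Proof.
have [|tau tauP] := @edge_coloring_of_arcs (superposed D) _ ord0
  (fun s t => arc_color (val s) (val t)).
  by move=> s t /superposed_adj[] /arc_color_sym.
exists tau; apply: (@normal_of_projection G (superposed D) sigma tau (fun s => proj (val s))) => //.
- move=> s; have [l [l3 _ l_all _]] := local_star_valid (valP s).
  apply: leq_trans l3; rewrite cardE -(size_map val); apply: uniq_leq_size.
    by rewrite map_inj_uniq ?enum_uniq //; apply: val_inj.
  move=> _ /mapP[t + ->]; rewrite mem_enum inE => /superposed_adj.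
  by apply: l_all; apply: valP.
- move=> s; have [l [_ l_in l_all l_col]] := local_star_valid (valP s).
  apply/setP=> x; rewrite -l_col; apply/imsetP/mapP => -[t].
    rewrite edge_in_nbrs => st ->; exists (val t); last exact: tauP.
    by apply: l_all; [exact: valP|exact/superposed_adj].
  move=> /l_in[vt st] ->.
  have st' : adj s (Sub t vt : superposed D) by apply/superposed_adj.
  by exists (Sub t vt); rewrite ?edge_in_nbrs // tauP.
- move=> s t /superposed_adj[] st; first exact: proj_link (valP s) st.
  by have [->|ts] := proj_link (valP t) st; [left|right; rewrite adj_sym].
Qed.

End Coloring.
End Joints.

Theorem theorem20 (G : sgraph) (sigma : {set G} -> 'I_5) (C : rel G)
    (D : superposition_data C) (Gt : sgraph) :
  snark G ->
  normal_coloring sigma ->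
  even_subgraph C ->
  isomorphic Gt (superposed D) ->
  (forall u : G, on_subgraph C u -> flower_superedge (sp_B D u)) ->
  exists tau : {set Gt} -> 'I_5, normal_coloring tau.
Proof.
move=> [G_cubic _ _] sigma_normal C_even [f f_iso] flowers.
pose good u (p : ({set sp_B D u} -> nat) * nat) := on_subgraph C u ->
  (p.2 = 0 \/ p.2 = 3) /\
  template_coloring (se_x (sp_B D u)) (se_y (sp_B D u)) (se_left (sp_B D u) (sp_d D u))
    (se_right (sp_B D u) (((sp_p D u)^-1)%g (sp_d D (sp_next D u)))) p.1 p.2.
have [cb cbP] : exists cb : forall u, ({set sp_B D u} -> nat) * nat, forall u, good u (cb u).
  apply: fin_all_exists => u; have [u_on|u_off] := boolP (on_subgraph C u).
    by have [c [b cb]] := flower_superedge_template (sp_d D u)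
      (((sp_p D u)^-1)%g (sp_d D (sp_next D u))) (flowers u u_on); exists (c, b).
  (* The superedges attached to vertices outside C are not inserted. *)
  by exists (fun=> 0, 0) => u_on; rewrite u_on in u_off.
have [tau tau_normal] := superposed_normal C_even G_cubic sigma_normal
  (fun u u_on => (cbP u u_on).1) (fun u u_on => (cbP u u_on).2).
by exists (fun S : {set Gt} => tau (f @: S)); apply: normal_coloring_iso tau_normal.
Qed.
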